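(* Let $T$ be a finite rooted tree with root $o$, and let $\{f_v : v\in V(T)\}$ be functions $f_v:[0,\infty)\to[0,\infty)$, extended by $f_v(\infty):=\liminf_{x\to\infty}f_v(x)$. Let $p=1+s>1$ and let $\{a_v:v\in V(T)\}$ be positive constants. Assign to the edge between $v\neq o$ and its parent the resistance $$R_v=\prod_{o<y\le v}a_y^{-1}.$$ Suppose $\{x_v : v\in V(T)\}$ solves the system $$x_v=\sum_{w:\,v\to w}f_w(x_w)\ \text{ for every } v \text{ that is not a leaf},\qquad x_w=\infty \text{ when } w \text{ is a leaf}.$$ (1) If there is $\kappa_1>0$ such that for every $v\in V(T)$ and $x\ge0$, $$f_v(x)\le\frac{a_vx}{(1+(\kappa_1x)^s)^{1/s}},$$ then $x_o\le \mathrm{cap}_p(T)/\kappa_1$. (2) If there is $\kappa_2>0$ such that for every $v\in V(T)$ and $x\ge0$, $$\frac{a_vx}{(1+(\kappa_2x)^s)^{1/s}}\le f_v(x),$$ then $\mathrm{cap}_p(T)/\kappa_2\le x_o$.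
   Context: The tree has at least one edge. A leaf is a vertex $\ne o$ with no children. $v\to w$ means $v$ is the parent of $w$ (the neighbor of $w$ closer to $o$); $y\le v$ means $y$ is on the path from $o$ to $v$, and $y<v$ means $y\le v$, $y\ne v$. Capacity: $\partial T$ is the set of maximal paths from $o$ directed away from the root (for finite $T$, paths from $o$ to a leaf). A flow $\mu$ is a nonnegative function on edges with $\mu(vw)=\sum_{y:w\to y}\mu(wy)$ whenever $v\to w$ and $w$ is not a leaf; $|\mu|=\sum_{y:o\to y}\mu(oy)$. For $p>1$, $s=p-1$ and resistances $R(e)$, set $V_\mu(y)=\sum_{e\in y}(\mu(e)R(e))^s$ for $y\in\partial T$, $V(\mu)=\sup_{y\in\partial T}V_\mu(y)$, and $\mathrm{cap}_p(T)=\sup\{|\mu| : \mu \text{ a flow on } T \text{ with } V(\mu)=1\}$. *)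

(* Defs.v *)
From HB Require Import structures.
From mathcomp Require Import all_boot all_order all_algebra.
From mathcomp Require Import all_classical all_reals all_analysis.

Set Implicit Arguments.
Unset Strict Implicit.
Unset Printing Implicit Defensive.
Import Order.TTheory GRing.Theory Num.Theory.
Import numFieldNormedType.Exports.
Local Open Scope classical_set_scope.
Local Open Scope ring_scope.

(* As in path.v, the path x :: p is given by its origin x and its tail p. *)
Definition simple_path (V : finType) (e : rel V) (x : V) (p : seq V) (y : V)
    : bool :=
  [&& path e x p, uniq (x :: p) & last x p == y].

Definition is_tree (V : finType) (e : rel V) : Prop :=
  [/\ symmetric e, irreflexive e
    & forall x y : V, exists! p : seq V, simple_path e x p y].

Section RootedTree.
Variables (V : finType) (e : rel V) (o : V).

(* y <= v *)
Definition tle (y v : V) : bool :=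
  `[< exists p : seq V, simple_path e o p v /\ y \in o :: p >].

(* y < v *)
Definition tlt (y v : V) : bool := tle y v && (y != v).

(* v -> w *)
Definition parent (v w : V) : bool := e v w && tlt v w.

Definition leaf (w : V) : bool := (w != o) && ~~ [exists y, parent w y].

End RootedTree.

(* Functions on edges (flows, resistances) are indexed by the lower endpoint:
   for w != o, [mu w] is the value on the edge between w and its parent, and
   the value [mu o] is never used.  A maximal path from o is given by the leaf
   y at which it ends; its edges are those whose lower endpoint w satisfies
   o < w <= y. *)
Section Capacity.
Variables (R : realType) (V : finType) (e : rel V) (o : V).

Definition is_flow (mu : V -> R) : Prop :=
  (forall w, w != o -> 0 <= mu w) /\
  (forall w, w != o -> ~~ leaf e o w ->
     mu w = \sum_(y | parent e o w y) mu y).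

Definition flow_strength (mu : V -> R) : R := \sum_(y | parent e o o y) mu y.

Definition path_energy (p : R) (r mu : V -> R) (y : V) : R :=
  \sum_(w | tlt e o o w && tle e o w y) (mu w * r w) `^ (p - 1).

Definition flow_energy (p : R) (r mu : V -> R) : \bar R :=
  ereal_sup [set (path_energy p r mu y)%:E | y in [set y | leaf e o y]].

Definition cap (p : R) (r : V -> R) : \bar R :=
  ereal_sup [set (flow_strength mu)%:E | mu in
    [set mu : V -> R | is_flow mu /\ flow_energy p r mu = 1%:E]].

Definition resistance (a : V -> R) (v : V) : R :=
  \prod_(y | tlt e o o y && tle e o y v) (a y)^-1.

End Capacity.

(* The extension of f : [0, oo) -> [0, oo) to [0, oo]; the value at -oo is
   irrelevant. *)
Definition extend (R : realType) (f : R -> R) (x : \bar R) : \bar R :=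
  match x with
  | r%:E => (f r)%:E
  | +oo%E => limf_einf (fun t : R => (f t)%:E) (pinfty_nbhs R)
  | -oo%E => 0%E
  end.

Definition solves_system (R : realType) (V : finType) (e : rel V) (o : V)
    (f : V -> R -> R) (x : V -> \bar R) : Prop :=
  [/\ forall v, (0 <= x v)%E,
      forall v, ~~ leaf e o v ->
        x v = (\sum_(w | parent e o v w) extend (f w) (x w))%E
    & forall w, leaf e o w -> x w = +oo%E].

(* Main.v *)
(* The capacity of the subtree at v, with resistances rescaled by R_v, solves
   the recursion psi_v = sum_w a_w G(psi_w), where G(t) = t / (1 + t^s)^(1/s)
   and G(oo) = 1.  With h_w = G(psi_w) and b_w = (1 + psi_w^s)^(-1/s), so that
   h_w^s + b_w^s = 1, the numbers
     theta(w) = R_w^(-1) h_w prod_(o < u < w) b_u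
   form a flow of strength psi_o, and the energies of its edges telescope to 1
   along every maximal path.  Such a flow is optimal: any other flow carries,
   along some maximal path, at least its fair share with respect to theta.
   Hence cap = psi_o.  As G is increasing and the hypotheses on f compare
   k x_v with the right-hand side of the same recursion, induction from
   the leaves to the root compares k x_o with psi_o. *)

Require Import Defs.
From HB Require Import structures.
From mathcomp Require Import all_boot all_order all_algebra.
From mathcomp Require Import all_classical all_reals all_analysis.
From mathcomp Require Import ring lra.
Set Implicit Arguments.
Unset Strict Implicit.
Unset Printing Implicit Defensive.
Import Order.TTheory GRing.Theory Num.Theory.
Import numFieldNormedType.Exports.
Local Open Scope ring_scope.

(** * Rooted trees: paths from the root, and induction in both directions *)

Section Tree.
Variables (V : finType) (e : rel V) (o : V).
Hypothesis hT : is_tree e.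

Lemma root_path_ex (v : V) : exists p, forall q, simple_path e o q v <-> q = p.
Proof.
case: hT => _ _ /(_ o v)[p [hp up]].
by exists p => q; split=> [/up|->].
Qed.

Definition root_path (v : V) : seq V := projT1 (cid (root_path_ex v)).

Lemma root_pathP q v : simple_path e o q v <-> q = root_path v.
Proof. exact: (projT2 (cid (root_path_ex v))). Qed.

Lemma simple_root_path v : simple_path e o (root_path v) v.
Proof. exact/root_pathP. Qed.

Lemma tleE y v : tle e o y v = (y \in o :: root_path v).
Proof.
apply/asboolP/idP => [[q [/root_pathP->]]//|yv].
by exists (root_path v); split=> //; apply: simple_root_path.
Qed.

Lemma root_path_root : root_path o = [::].
Proof. by apply/esym/root_pathP; rewrite /simple_path /= eqxx. Qed.

(** Cut the root path of [w] at [v]: both pieces are simple, so uniqueness identifies the first with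
    [root_path v] and the second with the single edge to [w]. *)
Lemma root_path_parent v w : parent e o v w ->
  root_path w = rcons (root_path v) w.
Proof.
move=> /andP[evw /andP[]]; rewrite tleE => vw vNw.
have := simple_root_path w; have : root_path w = root_path w by [].
move: {1 3}(root_path w) => p pE; rewrite -pE in vw *.
case/splitPl: vw pE => p1 p2 p1v pE.
rewrite /simple_path cat_path last_cat -cat_cons cat_uniq p1v => /and3P[].
case/andP=> pp1 pp2 /and3P[u1 d u2] /eqP l2.
have -> : p1 = root_path v by apply/root_pathP; rewrite /simple_path pp1 u1 p1v /=.
suff -> : p2 = [:: w] by rewrite cats1.
case: hT => _ _ /(_ v w)[q [_ uq]].
rewrite -[LHS]uq 1?(uq [:: w]) //.
  by rewrite /simple_path /= evw inE vNw /= eqxx.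
rewrite /simple_path pp2 l2 eqxx /= u2 andbT andbT.
apply/negP => vp2; move/hasPn: d => /(_ _ vp2) /=.
by rewrite -p1v mem_last.
Qed.

Lemma tle_root y : tle e o y o = (y == o).
Proof. by rewrite tleE root_path_root inE. Qed.

Lemma tle_parent v w y : parent e o v w ->
  tle e o y w = (y == w) || tle e o y v.
Proof. by move=> vw; rewrite !tleE (root_path_parent vw) -rcons_cons mem_rcons. Qed.

Lemma tle_refl v : tle e o v v.
Proof.
rewrite tleE; have /and3P[_ _ /eqP {1}<-] := simple_root_path v.
exact: mem_last.
Qed.

Lemma tlt_root y : tlt e o o y = (y != o).
Proof. by rewrite /tlt tleE mem_head eq_sym. Qed.

Lemma parent_Ntle v w : parent e o v w -> ~~ tle e o w v.
Proof.
move=> vw; rewrite tleE; have /and3P[_ + _] := simple_root_path w.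
by rewrite (root_path_parent vw) -rcons_cons rcons_uniq => /andP[].
Qed.

Lemma tlt_parent v w y : parent e o v w -> tlt e o y w = tle e o y v.
Proof.
move=> vw; rewrite /tlt (tle_parent _ vw).
by case: eqVneq => [->|_]; rewrite ?andbF ?andbT // (negbTE (parent_Ntle vw)).
Qed.

Lemma parent_neq_root v w : parent e o v w -> w != o.
Proof.
move=> vw; apply: contraNneq (parent_Ntle vw) => ->.
by rewrite tleE mem_head.
Qed.

Lemma tree_ind (P : V -> Prop) :
  P o -> (forall v w, parent e o v w -> P v -> P w) -> forall v, P v.
Proof.
move=> Po Pp v; have := simple_root_path v.
move: (root_path v) => q; elim/last_ind: q v => [v|q x IH v].
  by move=> /and3P[_ _ /eqP <-].
rewrite /simple_path rcons_path last_rcons -rcons_cons rcons_uniq.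
move=> /and3P[/andP[qp ex] /andP[xq uq] /eqP <-] {v}.
have sq : simple_path e o q (last o q) by rewrite /simple_path qp uq /=.
apply: Pp (IH _ sq); rewrite /parent ex /tlt /=; apply/andP; split.
  rewrite tleE; suff <- : rcons q x = root_path x.
    by rewrite -rcons_cons mem_rcons inE mem_last orbT.
  apply/root_pathP; rewrite /simple_path rcons_path qp ex -rcons_cons rcons_uniq.
  by rewrite xq uq last_rcons /=.
by apply: contraNneq xq => <-; exact: mem_last.
Qed.

(** Passing to a child lengthens the root path by one, and a simple path has at most [#|V|]
    vertices, so [#|V| - size (root_path v)] decreases. *)
Lemma tree_ind_up (P : V -> Prop) :
  (forall v, (forall w, parent e o v w -> P w) -> P v) -> forall v, P v.
Proof.
move=> IH v; have [n] := ubnP (#|V| - size (root_path v)).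
elim: n v => // n IHn v; rewrite ltnS => vn.
apply: IH => w vw; apply: IHn; apply: leq_trans vn.
rewrite (root_path_parent vw) size_rcons; apply: ltn_sub2l => //.
have /and3P[_ + _] := simple_root_path v => /card_uniqP /= <-.
exact: max_card.
Qed.

(** As [F h v] depends on [h] only at the children of [v], the iterates of [F] stabilize at each
    vertex; finiteness of [V] gives one iterate stable everywhere. *)
Lemma tree_rec (T : Type) (t0 : T) (F : (V -> T) -> V -> T) :
  (forall h h' v, (forall w, parent e o v w -> h w = h' w) -> F h v = F h' v) ->
  exists h, forall v, h v = F h v.
Proof.
move=> FE.
have stab v : exists n, forall m, (n <= m)%N ->
    iter m.+1 F (fun=> t0) v = iter m F (fun=> t0) v.
  elim/tree_ind_up: v => v IH.
  have /choice[n hn] w : exists k, parent e o v w -> forall m, (k <= m)%N ->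
      iter m.+1 F (fun=> t0) w = iter m F (fun=> t0) w.
    by have [/IH[k hk]|_] := boolP (parent e o v w); [exists k|exists 0%N].
  exists (\max_w n w).+1 => -[//|m]; rewrite ltnS => nm.
  rewrite /=; apply: FE => w vw; apply: (hn w) => //.
  by apply: leq_trans nm; exact: leq_bigmax.
have [n hn] := choice stab.
exists (iter (\max_w n w) F (fun=> t0)) => v.
by apply/esym/(hn v); exact: leq_bigmax.
Qed.

Lemma big_path_root (T : Type) (idx : T) (op : T -> T -> T) (F : V -> T) :
  \big[op/idx]_(u | tlt e o o u && tle e o u o) F u = idx.
Proof.
by rewrite big_pred0 // => u; rewrite tlt_root tle_root andNb.
Qed.

Lemma big_path_parent (T : Type) (idx : T) (op : Monoid.com_law idx)
    (F : V -> T) v w : parent e o v w ->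
  \big[op/idx]_(u | tlt e o o u && tle e o u w) F u =
    op (F w) (\big[op/idx]_(u | tlt e o o u && tle e o u v) F u).
Proof.
move=> vw; rewrite (bigD1 w) /=; last first.
  by rewrite tlt_root (parent_neq_root vw) tle_refl.
congr (op _ _); apply: eq_bigl => u.
rewrite (tle_parent _ vw) -andbA; congr andb.
by case: eqVneq => [->|_]; rewrite /= ?andbT // (negbTE (parent_Ntle vw)).
Qed.

Hypothesis hedge : exists v w : V, e v w.

(** Only the root needs [hedge], since [leaf] excludes it: a childless root would be the only
    vertex, and the edge a loop. *)
Lemma Nleaf_parent v : ~~ leaf e o v -> exists w, parent e o v w.
Proof.
rewrite negb_and !negbK => /orP[/eqP->{v}|/existsP//].
apply: contrapT => /forallNP No.
have allo v : v = o.
  by elim/tree_ind: v => // v w vw vo; case: (No w); rewrite vo in vw.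
have [_ irr _] := hT.
have [y [z]] := hedge.
by rewrite (allo y) (allo z) irr.
Qed.

Lemma parent_Nleaf v w : parent e o v w -> ~~ leaf e o v.
Proof. by move=> vw; rewrite negb_and !negbK; apply/orP; right; apply/existsP; exists w. Qed.

Lemma leaf_neq_root v : leaf e o v -> v != o.
Proof. by case/andP. Qed.

End Tree.

(** * Capacity from a flow whose energy is 1 along every path to a leaf *)

Section Capacity.
Variables (R : realType) (V : finType) (e : rel V) (o : V).
Hypothesis hT : is_tree e.
Hypothesis hedge : exists v w : V, e v w.

(** Greedy descent, ended by finiteness. The root is exempt from [Q] because no edge lies above
    it. *)
Lemma leaf_path (Q : V -> Prop) :
  (forall v, ~~ leaf e o v -> v = o \/ Q v ->
     exists2 w, parent e o v w & Q w) ->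
  exists2 y, leaf e o y & forall w, w != o -> tle e o w y -> Q w.
Proof.
move=> step.
suff H v : v = o \/ Q v -> (forall w, w != o -> tle e o w v -> Q w) ->
    exists2 y, leaf e o y & forall w, w != o -> tle e o w y -> Q w.
  by apply: (H o); [left|move=> w /negbTE wo; rewrite (tle_root _ hT) wo].
elim/(tree_ind_up (o := o) hT): v => v IH vQ allQ.
have [lv|/step/(_ vQ)[w vw Qw]] := boolP (leaf e o v); first by exists v.
apply: (IH w vw); first by right.
by move=> u uo; rewrite (tle_parent hT _ vw) => /predU1P[->//|]; exact: allQ.
Qed.

Section UnitEnergyFlow.
Variables (p : R) (r th : V -> R).
Hypothesis p1 : 1 < p.
Hypothesis r_ge0 : forall v, 0 <= r v.
Hypothesis th_flow : is_flow e o th.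
Hypothesis th_gt0 : forall w, w != o -> 0 < th w.
Hypothesis th_energy : forall y, leaf e o y -> path_energy e o p r th y = 1.

Lemma strength_gt0 : 0 < flow_strength e o th.
Proof.
have /(Nleaf_parent hT hedge)[w ow] : ~~ leaf e o o by rewrite /leaf eqxx.
rewrite /flow_strength (bigD1 w)//= ltr_wpDr ?th_gt0 ?(parent_neq_root hT ow)//.
by apply: sumr_ge0 => u /andP[/(parent_neq_root hT)/th_gt0/ltW].
Qed.

(* Flow conservation for [mu] and [th] yields a child along which the ratio
   [mu / th] does not drop; iterating from the root reaches a leaf [y] with
   [V_mu(y) >= (|mu| / |th|)^(p - 1)]. *)
Lemma strength_le mu : is_flow e o mu ->
  (forall y, leaf e o y -> path_energy e o p r mu y <= 1) ->
  flow_strength e o mu <= flow_strength e o th.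
Proof.
move=> [mu0 muE] mu1; set c := flow_strength e o mu / flow_strength e o th.
have th0 := strength_gt0.
have c0 : 0 <= c.
  apply: divr_ge0 (ltW th0); apply: sumr_ge0 => w ow.
  exact: mu0 (parent_neq_root hT ow).
have [y ly cy] : exists2 y, leaf e o y &
    forall w, w != o -> tle e o w y -> c * th w <= mu w.
  apply: leaf_path => v Nlv vQ.
  apply: contrapT => /forall2NP No.
  have lt_child w : parent e o v w -> mu w < c * th w.
    by move=> vw; have [//|/negP] := No w; rewrite -ltNge.
  (* At the root this is an equality by the choice of [c]; elsewhere conservation turns it into the
     ratio bound already known at [v]. *)
  suff : c * \sum_(w | parent e o v w) th w <= \sum_(w | parent e o v w) mu w.
    apply/negP; rewrite -ltNge mulr_sumr.
    have [w vw] := Nleaf_parent hT hedge Nlv.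
    rewrite (bigD1 w) //= [ltRHS](bigD1 w) //=.
    apply: ltr_leD; first exact: lt_child.
    by apply: ler_sum => u /andP[/lt_child/ltW].
  have [->|vo] := eqVneq v o.
    by rewrite -/(flow_strength e o th) -/(flow_strength e o mu) /c divfK ?gt_eqF.
  case: vQ => [vo'|]; first by rewrite vo' eqxx in vo.
  by case: th_flow => _ thE; rewrite thE // muE.
rewrite -[leRHS]mul1r -ler_pdivrMr // -/c.
have s0 : 0 < p - 1 by rewrite subr_gt0.
rewrite leNgt; apply/negP => c1.
have := mu1 _ ly; apply/negP; rewrite -ltNge.
apply: (@lt_le_trans _ _ (c `^ (p - 1))).
  suff : 1 `^ (p - 1) < c `^ (p - 1) by rewrite powR1.
  by rewrite gt0_ltr_powR // nnegrE.
suff : c `^ (p - 1) * path_energy e o p r th y <= path_energy e o p r mu y.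
  by rewrite th_energy // mulr1.
rewrite mulr_sumr; apply: ler_sum => w /andP[].
rewrite (tlt_root _ hT) => wo wy.
have thw := th_gt0 wo.
rewrite -powRM //; last by rewrite mulr_ge0 // ltW.
apply: (ge0_ler_powR (ltW s0)); rewrite ?nnegrE.
- by rewrite mulr_ge0 // mulr_ge0 // ltW.
- by rewrite mulr_ge0 ?mu0.
by rewrite mulrA ler_wpM2r ?cy.
Qed.

Lemma cap_unit_energy : cap e o p r = (flow_strength e o th)%:E.
Proof.
apply/eqP; rewrite eq_le; apply/andP; split.
  apply: ge_ereal_sup => _ [mu [muf muV] <-]; rewrite lee_fin.
  apply: strength_le => // y ly; rewrite -lee_fin -muV.
  by apply: ereal_sup_ubound; exists y.
apply: ereal_sup_ubound; exists th => //; split=> //.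
(* Some leaf must exist: the supremum of an empty set of energies would be [-oo], not 1. *)
have [|y ly _] := @leaf_path (fun=> True).
  by move=> v /(Nleaf_parent hT hedge)[w vw] _; exists w.
rewrite /flow_energy -[RHS]ereal_sup1; congr ereal_sup.
apply/seteqP; split=> [_ [z lz <-]|_ ->]; first by rewrite th_energy.
by exists y => //; rewrite th_energy.
Qed.

End UnitEnergyFlow.
End Capacity.

(** * The flow theta and its strength and energy *)

Section OptimalFlow.
Variables (R : realType) (V : finType) (e : rel V) (o : V).
Hypothesis hT : is_tree e.
Hypothesis hedge : exists v w : V, e v w.
Variables (p : R) (a h b : V -> R).
Hypothesis p1 : 1 < p.
Hypothesis a_gt0 : forall v, 0 < a v.
Hypothesis h_gt0 : forall v, 0 < h v.
Hypothesis b_gt0 : forall v, ~~ leaf e o v -> 0 < b v.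
Hypothesis b_leaf : forall v, leaf e o v -> b v = 0.
Hypothesis hb : forall v, h v `^ (p - 1) + b v `^ (p - 1) = 1.
Hypothesis h_rec : forall v, v != o -> ~~ leaf e o v ->
  h v = b v * \sum_(w | parent e o v w) a w * h w.

(** The product stops strictly above [w], so the value 0 of [b] at a leaf never enters. *)
Definition optimal_flow (w : V) : R :=
  (resistance e o a w)^-1 * h w * \prod_(u | tlt e o o u && tlt e o u w) b u.

Let B v := \prod_(u | tlt e o o u && tle e o u v) b u.

Lemma resistance_gt0 v : 0 < resistance e o a v.
Proof. by apply: prodr_gt0 => u _; rewrite invr_gt0. Qed.

Let B_gt0 v : ~~ leaf e o v -> 0 < B v.
Proof.
elim/(tree_ind (o := o) hT): v => [_|v w vw IH Nlw]; first by rewrite /B big_path_root.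
by rewrite /B (big_path_parent hT _ _ vw)/= mulr_gt0 ?b_gt0 ?IH ?(parent_Nleaf vw).
Qed.

Let B_ge0 v : 0 <= B v.
Proof.
apply: prodr_ge0 => u _; have [lu|/b_gt0/ltW//] := boolP (leaf e o u).
by rewrite b_leaf.
Qed.

Let optimal_flow_parent v w : parent e o v w ->
  optimal_flow w = (resistance e o a w)^-1 * h w * B v.
Proof.
move=> vw; rewrite /optimal_flow; congr (_ * _); apply: eq_bigl => u.
by rewrite (tlt_parent hT _ vw).
Qed.

(** Passing from [v] to a child [w] multiplies the inverse resistance by [a w]. This gives
    conservation at inner vertices and the strength at the root. *)
Let sum_optimal_flow v : \sum_(w | parent e o v w) optimal_flow w =
  (resistance e o a v)^-1 * B v * \sum_(w | parent e o v w) a w * h w.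
Proof.
rewrite mulr_sumr; apply: eq_bigr => w vw.
rewrite (optimal_flow_parent vw) /resistance (big_path_parent hT _ _ vw) /= invfM invrK.
ring.
Qed.

Lemma optimal_flow_gt0 w : w != o -> 0 < optimal_flow w.
Proof.
elim/(tree_ind (o := o) hT): w => [/eqP//|v w vw _ _].
rewrite (optimal_flow_parent vw) !mulr_gt0 ?invr_gt0 ?resistance_gt0 //.
exact: B_gt0 (parent_Nleaf vw).
Qed.

Lemma optimal_flow_flow : is_flow e o optimal_flow.
Proof.
split=> [w /optimal_flow_gt0/ltW//|w wo Nlw].
rewrite sum_optimal_flow -mulrA mulrCA.
(* The induction serves only as a case analysis that exposes the parent [v] of [w]. *)
elim/(tree_ind (o := o) hT): w wo Nlw => [/eqP//|v w vw _ wo Nlw].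
rewrite (optimal_flow_parent vw) {1}(h_rec wo Nlw) /B (big_path_parent hT _ _ vw) /=.
ring.
Qed.

Lemma optimal_flow_strength : flow_strength e o optimal_flow =
  \sum_(w | parent e o o w) a w * h w.
Proof.
by rewrite /flow_strength sum_optimal_flow /B /resistance !big_path_root // invr1 !mul1r.
Qed.

(* Since [h^s + b^s = 1], the energy of the edge above [w] is the decrease of
   [B^s] along it, so the sum telescopes. *)
Let optimal_flow_energy_B v :
  path_energy e o p (resistance e o a) optimal_flow v = 1 - B v `^ (p - 1).
Proof.
elim/(tree_ind (o := o) hT): v => [|v w vw IH].
  by rewrite /path_energy /B !big_path_root // powR1 subrr.
rewrite /path_energy (big_path_parent hT _ _ vw) /=.
rewrite -/(path_energy e o p (resistance e o a) optimal_flow v) IH.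
rewrite /B (big_path_parent hT _ _ vw) -/(B v) /= (optimal_flow_parent vw).
have -> : (resistance e o a w)^-1 * h w * B v * resistance e o a w = h w * B v.
  by rewrite mulrC !mulrA divff ?mul1r // gt_eqF // resistance_gt0.
have bw : 0 <= b w.
  by have [/b_leaf->|/b_gt0/ltW] := boolP (leaf e o w).
rewrite !powRM ?(ltW (h_gt0 w)) //.
have := hb w; move: (h w `^ _) (b w `^ _) (B v `^ _) => x y z xy.
by rewrite (_ : x = 1 - y); [ring|lra].
Qed.

Lemma optimal_flow_energy y : leaf e o y ->
  path_energy e o p (resistance e o a) optimal_flow y = 1.
Proof.
move=> ly; rewrite optimal_flow_energy_B /B (bigD1 y) /=; last first.
  by rewrite (tlt_root _ hT) tle_refl // (leaf_neq_root ly).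
(* Here [p != 1] matters, because a real power with exponent 0 is 1 even at 0. *)
by rewrite b_leaf // mul0r powR0 ?subr0 // subr_eq0 gt_eqF.
Qed.

Lemma cap_resistance : cap e o p (resistance e o a) =
  (\sum_(w | parent e o o w) a w * h w)%:E.
Proof.
rewrite -optimal_flow_strength; apply: cap_unit_energy => //.
- by move=> v; exact/ltW/resistance_gt0.
- exact: optimal_flow_flow.
- exact: optimal_flow_gt0.
- exact: optimal_flow_energy.
Qed.

End OptimalFlow.

(** * The function [G] of the recursion, as [gain], and its factor [damping] *)

Section Gain.
Variables (R : realType) (s : R).
Hypothesis s0 : 0 < s.

Definition damping (t : R) : R := ((1 + t `^ s) `^ s^-1)^-1.
Definition gain (t : R) : R := t * damping t.

Lemma gainE t : gain t = t * damping t. Proof. by []. Qed.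

Let base_gt0 (t : R) : 0 < 1 + t `^ s.
Proof. by rewrite ltr_pwDl // powR_ge0. Qed.

Lemma powR_invK (t : R) : 0 <= t -> (t `^ s^-1) `^ s = t.
Proof. by move=> t0; rewrite -powRrM mulVf ?powRr1 ?gt_eqF. Qed.

Lemma damping_gt0 t : 0 < damping t.
Proof. by rewrite invr_gt0 powR_gt0. Qed.

Lemma damping_powR t : damping t `^ s = (1 + t `^ s)^-1.
Proof.
rewrite /damping -powR_inv1 ?powR_ge0 // powRAC.
by rewrite powR_invK ?(ltW (base_gt0 t)) // powR_inv1 // ltW.
Qed.

Lemma gain_damping t : 0 <= t -> gain t `^ s + damping t `^ s = 1.
Proof.
move=> t0; rewrite powRM // ?ltW ?damping_gt0 // damping_powR.
by rewrite -[X in _ + X]mul1r -mulrDl addrC divff // gt_eqF.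
Qed.

Lemma gain_gt0 t : 0 < t -> 0 < gain t.
Proof. by move=> t0; rewrite mulr_gt0 ?damping_gt0. Qed.

Lemma gain_ge0 t : 0 <= t -> 0 <= gain t.
Proof. by move=> t0; rewrite mulr_ge0 // ltW ?damping_gt0. Qed.

Let le_powR (x y : R) : 0 <= x -> 0 <= y -> x `^ s <= y `^ s -> x <= y.
Proof.
move=> x0 y0; rewrite leNgt => xy; rewrite leNgt; apply: contra xy => yx.
by rewrite gt0_ltr_powR ?nnegrE.
Qed.

(** By [gain_damping] it suffices that the [s]-th power of [damping], which is [(1 + t^s)^-1],
    decreases. *)
Lemma le_gain t u : 0 <= t -> t <= u -> gain t <= gain u.
Proof.
move=> t0 tu; have u0 := le_trans t0 tu.
apply: le_powR; [exact: gain_ge0|exact: gain_ge0|].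
have swap (x y x' y' : R) : x + y = 1 -> x' + y' = 1 -> y' <= y -> x <= x'.
  lra.
apply: swap (gain_damping t0) (gain_damping u0) _.
rewrite !damping_powR lef_pV2 ?posrE // lerD2l.
by apply: (ge0_ler_powR (ltW s0)); rewrite ?nnegrE.
Qed.

Lemma gain_le1 t : 0 <= t -> gain t <= 1.
Proof.
move=> t0; apply: le_powR; [exact: gain_ge0|exact: ler01|].
by rewrite powR1 -[leRHS](gain_damping t0) lerDl powR_ge0.
Qed.

(** Solving [c^s = t^s / (1 + t^s)] for [t] gives the witness [c / (1 - c^s)^(1/s)]. *)
Lemma gain_surj c : 0 <= c < 1 -> exists2 t, 0 <= t & gain t = c.
Proof.
move=> /andP[c0 c1]; have d0 : 0 < 1 - c `^ s.
  rewrite subr_gt0; suff : c `^ s < 1 `^ s by rewrite powR1.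
  by rewrite gt0_ltr_powR ?nnegrE.
have e0 : 0 < (1 - c `^ s) `^ s^-1 by rewrite powR_gt0.
exists (c / (1 - c `^ s) `^ s^-1); first by rewrite divr_ge0 // ltW.
rewrite /gain /damping powRM ?invr_ge0 ?(ltW e0) //.
have -> : ((1 - c `^ s) `^ s^-1)^-1 `^ s = (1 - c `^ s)^-1.
  rewrite -[X in X `^ s]powR_inv1 ?(ltW e0) // powRAC powR_invK ?(ltW d0) //.
  by rewrite powR_inv1 // ltW.
have -> : 1 + c `^ s / (1 - c `^ s) = (1 - c `^ s)^-1.
  by field; rewrite gt_eqF.
have -> : (1 - c `^ s)^-1 `^ s^-1 = ((1 - c `^ s) `^ s^-1)^-1.
  by rewrite -powR_inv1 ?(ltW d0) // powRAC powR_inv1 // ltW.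
by rewrite invrK divfK // gt_eqF.
Qed.

Lemma bound_gain (k a t : R) : 0 < k ->
  a * t / (1 + (k * t) `^ s) `^ s^-1 = a / k * gain (k * t).
Proof.
move=> k0; rewrite /gain /damping; move: (_ `^ s^-1)^-1 => D.
by rewrite [RHS]mulrA mulrA divfK ?gt_eqF.
Qed.

End Gain.

(* Keeps conversion checks from unfolding real powers down to [expR]. *)
Opaque damping gain.

(** * Bounds for the value of [f] at infinity *)

Section Extend.
Variables (R : realType) (f : R -> R) (t0 M : R).

(** Every neighbourhood of infinity contains some [t >= t0], so the infimum of [f] over it is at
    most [M]. *)
Lemma extend_pinfty_le :
  (forall t, t0 <= t -> f t <= M) -> (extend f +oo <= M%:E)%E.
Proof.
move=> fM; rewrite /= limf_einfE; apply: ge_ereal_sup => _ [A A_oo <-].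
have [t [At t0t]] : exists t, A t /\ t0 <= t.
  apply: (@filter_ex _ (pinfty_nbhs R)); apply: filterI => //.
  exact/nbhs_pinfty_ge/num_real.
apply: ge_ereal_inf; exists (f t)%:E; first by exists t.
by rewrite lee_fin fM.
Qed.

Lemma extend_pinfty_ge :
  (forall t, t0 <= t -> M <= f t) -> (M%:E <= extend f +oo)%E.
Proof.
move=> Mf; rewrite /= limf_einfE; apply: le_ereal_sup_tmp.
exists (ereal_inf [set (f t)%:E | t in [set t | t0 <= t]]%classic).
  exists [set t | t0 <= t]%classic => //.
  exact/nbhs_pinfty_ge/num_real.
by apply: le_ereal_inf_tmp => _ [t /= t0t <-]; rewrite lee_fin Mf.
Qed.

End Extend.

(** * Solution of the extremal recursion, and comparison with [x] *)

Lemma extremal_system (R : realType) (V : finType) (e : rel V) (o : V)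
    (hT : is_tree e) (hedge : exists v w : V, e v w) (p s : R)
    (hps : p = 1 + s) (s0 : 0 < s) (a : V -> R) (a_gt0 : forall v, 0 < a v) :
  exists h : V -> R, [/\ forall v, 0 < h v, forall v, leaf e o v -> h v = 1,
    forall v, ~~ leaf e o v -> h v = gain s (\sum_(w | parent e o v w) a w * h w)
  & cap e o p (resistance e o a) = (\sum_(w | parent e o o w) a w * h w)%:E].
Proof.
(* The recursion is run on [h = G(psi)] rather than on psi, which is infinite at the leaves. *)
have [|h hE] := tree_rec (o := o) hT 1 (F := fun h v => if leaf e o v then 1 else
    gain s (\sum_(w | parent e o v w) a w * h w)).
  move=> h h' v hh'; suff -> : \sum_(w | parent e o v w) a w * h w =
      \sum_(w | parent e o v w) a w * h' w by [].
  by apply: eq_bigr => w /hh' ->.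
have h_leaf v : leaf e o v -> h v = 1 by move=> lv; rewrite hE lv.
have h_Nleaf v : ~~ leaf e o v ->
    h v = gain s (\sum_(w | parent e o v w) a w * h w).
  by move=> /negbTE lv; rewrite hE lv.
have sum_gt0 v : (forall w, parent e o v w -> 0 < h w) -> ~~ leaf e o v ->
    0 < \sum_(w | parent e o v w) a w * h w.
  move=> h0 /(Nleaf_parent hT hedge)[w vw].
  rewrite (bigD1 w) //= ltr_wpDr ?mulr_gt0 ?h0 //.
  by apply: sumr_ge0 => u /andP[vu _]; rewrite mulr_ge0 ?ltW ?h0.
have h_gt0 v : 0 < h v.
  elim/(tree_ind_up (o := o) hT): v => v IH.
  have [/h_leaf->//|Nlv] := boolP (leaf e o v).
  by rewrite h_Nleaf // gain_gt0 // sum_gt0.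
exists h; split=> //.
have ps : p - 1 = s by rewrite hps addrC addKr.
(* At a leaf, 0 is the limit of [damping] at infinity and keeps [h^s + b^s = 1]. *)
pose b v := if leaf e o v then 0 else
  damping s (\sum_(w | parent e o v w) a w * h w).
apply: (@cap_resistance _ _ _ _ hT hedge p a h b) => //.
- by rewrite hps ltrDl.
- by move=> v /negbTE Nlv; rewrite /b Nlv damping_gt0.
- by move=> v lv; rewrite /b lv.
- move=> v; rewrite ps /b; case: ifPn => [lv|Nlv].
    by rewrite h_leaf // powR1 powR0 ?addr0 // gt_eqF.
  by rewrite h_Nleaf // gain_damping // ltW // sum_gt0.
- by move=> v _ Nlv; rewrite {1}h_Nleaf // /b (negbTE Nlv) gainE mulrC.
Qed.

Theorem theorem3p2 (R : realType) (V : finType) (e : rel V) (o : V)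
    (hT : is_tree e) (hedge : exists v w : V, e v w)
    (f : V -> R -> R) (hf : forall v x, 0 <= x -> 0 <= f v x)
    (p s : R) (hps : p = 1 + s) (hp : 1 < p)
    (a : V -> R) (ha : forall v, 0 < a v)
    (x : V -> \bar R) (hx : solves_system e o f x) :
  (forall k1 : R, 0 < k1 ->
     (forall v t, 0 <= t ->
        f v t <= a v * t / (1 + (k1 * t) `^ s) `^ s^-1) ->
     (x o <= cap e o p (resistance e o a) * (k1^-1)%:E)%E) /\
  (forall k2 : R, 0 < k2 ->
     (forall v t, 0 <= t ->
        a v * t / (1 + (k2 * t) `^ s) `^ s^-1 <= f v t) ->
     (cap e o p (resistance e o a) * (k2^-1)%:E <= x o)%E).
Proof.
have s0 : 0 < s by move: hp; rewrite hps ltrDl.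
have [h [h_gt0 h_leaf h_Nleaf ->]] := extremal_system o hT hedge hps s0 ha.
case: hx => x0 x_Nleaf x_leaf.
(* This is psi at non-leaves only: at a leaf the sum is empty, hence 0 instead of infinity, so both
   inductions exclude leaves. *)
pose S v := \sum_(w | parent e o v w) a w * h w.
have S0 v : 0 <= S v by apply: sumr_ge0 => w _; rewrite mulr_ge0 ?ltW.
have Nlo : ~~ leaf e o o by rewrite /leaf eqxx.
have sumS v k : (S v / k)%:E = (\sum_(w | parent e o v w) (a w / k * h w)%:E)%E.
  by rewrite sumEFin mulr_suml; congr EFin; apply: eq_bigr => w _; rewrite mulrAC.
split=> k k0 fk; rewrite -EFinM -/(S o).
  suff xS v : ~~ leaf e o v -> (x v <= (S v / k)%:E)%E by exact: xS.
  elim/(tree_ind_up (o := o) hT): v => v IH Nlv.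
  rewrite x_Nleaf // sumS; apply: lee_sum => w vw.
  have ak0 : 0 < a w / k by rewrite divr_gt0.
  have [lw|Nlw] := boolP (leaf e o w).
    rewrite x_leaf // h_leaf // mulr1; apply: (@extend_pinfty_le _ _ 0) => t t0.
    apply: le_trans (fk _ _ t0) _; rewrite bound_gain // ger_pMr //.
    by rewrite gain_le1 // mulr_ge0 // ltW.
  (* The induction hypothesis bounds [x w] by a real number, which rules out [+oo]. *)
  move: (x0 w) (IH _ vw Nlw); case: (x w) => [t| |] //=.
  rewrite !lee_fin => t0 tS; apply: le_trans (fk _ _ t0) _.
  have tS' : k * t <= S w by rewrite mulrC -ler_pdivlMr.
  rewrite bound_gain // ler_pM2l // (h_Nleaf _ Nlw).
  by apply: (le_gain s0 _ tS'); rewrite mulr_ge0 // ltW.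
suff xS v : ~~ leaf e o v -> ((S v / k)%:E <= x v)%E by exact: xS.
elim/(tree_ind_up (o := o) hT): v => v IH Nlv.
rewrite x_Nleaf // sumS; apply: lee_sum => w vw.
have ak0 : 0 < a w / k by rewrite divr_gt0.
(* Unlike in the upper bound, [x w] may be infinite at an inner vertex as well as at a leaf. *)
have oo : (x w = +oo -> (a w / k * h w)%:E <= extend (f w) (x w))%E.
  (* The bound 1 for [gain] is only approached, so the inequality is proved up to each factor
     [c < 1], using that [gain] is at least [c] from [t0] on. *)
  move=> ->; apply/lee_mul01Pr => [|c /andP[c0 c1]].
    by rewrite lee_fin mulr_ge0 // ltW.
  have [t0 t0_ge0 t0c] : exists2 t, 0 <= t & gain s t = c.
    by apply: gain_surj => //; rewrite ltW.
  have h1 : h w <= 1.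
    have [/h_leaf->//|Nlw] := boolP (leaf e o w).
    by rewrite h_Nleaf //; exact: gain_le1 (S0 w).
  rewrite -EFinM; apply: (@extend_pinfty_ge _ _ (t0 / k)) => t t0t.
  have kt : t0 <= k * t by rewrite mulrC -ler_pdivrMr.
  have t_ge0 : 0 <= t by apply: le_trans t0t; rewrite divr_ge0 // ltW.
  apply: le_trans (fk _ _ t_ge0); rewrite bound_gain // mulrCA ler_pM2l //.
  apply: le_trans (le_gain s0 t0_ge0 kt); rewrite t0c.
  by rewrite ger_pMr.
have [/x_leaf/oo//|Nlw] := boolP (leaf e o w).
move: (x0 w) (IH _ vw Nlw) oo; case: (x w) => [t| |] //=; last by move=> _ _; apply.
rewrite !lee_fin => t0 tS _; apply: le_trans (fk _ _ t0).
have tS' : S w <= k * t by rewrite mulrC -ler_pdivrMr.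
rewrite bound_gain // ler_pM2l // (h_Nleaf _ Nlw).
exact: (le_gain s0 (S0 w) tS').
Qed.
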